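(* Let $M$ be a Hermitian manifold of dimension $n\geq 2$ admitting a Kähler metric $g$ on $T^{1,0}(M)$, with curvature term denoted $\Theta_M$, and let $\Omega\subset M$ be a relatively compact domain with Lipschitz boundary. Let $\tilde g$ denote a Hermitian metric for $T^{1,0}(M)$ (not necessarily Kähler) with curvature term denoted $\tilde\Theta_M$. Suppose that for some $0\leq a<b\leq 1$ there exists a Lipschitz defining function $\rho$ for $\Omega$ such that $\rho|_\Omega\in C^2(\Omega)$ and such that for every $Z\in T^{1,0}(\Omega)$ $$\left((-\rho)^\eta\tilde\Theta_M-\partial\bar\partial(-\rho)^\eta\right)(Z,\bar Z)\geq(-\rho)^\eta\left|\tau_\nabla Z^\flat\right|^2$$ on $\Omega$ for $\eta=a$ and $\eta=b$, where $\tau_\nabla$, $\flat$ and $|\cdot|$ are taken with respect to $\tilde g$ and its Chern connection $\nabla$. Then there exists $\psi\in C^2(M)$ such that for every $Z\in T^{1,0}(\Omega)$ $$\left((-\rho)^\eta\left(\Theta_M+\partial\bar\partial\psi\right)-\partial\bar\partial(-\rho)^\eta\right)(Z,\bar Z)\geq 0$$ on $\Omega$ for $\eta=a$ and $\eta=b$.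
   Context: For a Hermitian metric $h=\langle\cdot,\cdot\rangle$ (linear in the first slot) on the holomorphic tangent bundle $T^{1,0}(M)$ of a complex manifold $M$ of dimension $n$, let $\nabla$ be the Chern connection on $T^{1,0}(M)$, and also the affine connection it induces on $T(M)$. Torsion: $T_\nabla(X,Y)=\nabla_XY-\nabla_YX-[X,Y]$. Curvature: $R_\nabla(X,Y)=\nabla_X\nabla_Y-\nabla_Y\nabla_X-\nabla_{[X,Y]}$. Both are extended complex-linearly in $X,Y$. The curvature term of $h$ is the (1,1)-form $\sum_{j=1}^n\theta^j(R_\nabla(Z_1,\bar Z_2)W_j)$, $Z_1,Z_2\in T^{1,0}(M)$, where $\{W_j\}$ is any local basis of $T^{1,0}(M)$ with dual basis $\{\theta^j\}$ (independent of the basis); it is denoted $\Theta_M$ for $h=g$ and $\tilde\Theta_M$ for $h=\tilde g$. For a 1-form $\phi$, $(\tau_\nabla\phi)(X,Y)=\phi(T_\nabla(X,Y))$. For $Z\in T^{1,0}(M)$, $Z^\flat$ is the (1,0)-form $Z^\flat(W)=\langle W,Z\rangle$. The norm on 2-forms is such that for an orthonormal frame $\{\theta^j\}$ of (1,0)-forms, $\{\theta^j\wedge\theta^k\}_{j<k}$ is orthonormal. For open $U$, $Z\in T^{1,0}(U)$ means a (1,0)-vector (field) over $U$. In local coordinates $\partial\bar\partial f(Z,\bar Z)=\sum_{j,k}\frac{\partial^2 f}{\partial z_j\partial\bar z_k}Z_j\bar Z_k$. $C^2(M)$ consists of real-valued functions here. A Lipschitz defining function for $\Omega$ is a real-valued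 Lipschitz function $\rho$ with $\Omega=\{\rho<0\}$, $\rho=0$ on $\partial\Omega$, that is nondegenerate at the boundary, so that $-\rho$ is comparable on $\Omega$ to the distance to $\partial\Omega$. *)

(* Defs.v *)
From HB Require Import structures.
From mathcomp Require Import all_boot all_order all_algebra.
From mathcomp Require Import complex.
From mathcomp Require Import all_classical all_reals all_analysis.
From mathcomp Require Import ring.
Set Implicit Arguments.
Unset Strict Implicit.
Unset Printing Implicit Defensive.
Import Order.TTheory GRing.Theory Num.Theory.
Import numFieldNormedType.Exports.
Local Open Scope classical_set_scope.
Local Open Scope ring_scope.
Local Open Scope complex_scope.

(* R[i]^o is R[i] as a normed module over itself, so that C^n carries its
   topology and [differentiable] means complex differentiable. *)
Notation Cn R n := ('rV[(R[i])^o]_n).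

Section Calculus.
Variables (R : realType) (n : nat).
Implicit Types (f : Cn R n -> R[i]) (x v w : Cn R n) (U : set (Cn R n)).

(* C^n as the Euclidean space R^(2n). *)
Definition dotR v w : R := \sum_j complex.Re (v 0 j * conjc (w 0 j)).
Definition normR v : R := Num.sqrt (dotR v v).

Definition derivableR v f x : Prop :=
  derivable (fun t : R => complex.Re (f (x + t%:C *: v))) 0 1 /\
  derivable (fun t : R => complex.Im (f (x + t%:C *: v))) 0 1.

Definition derR v f x : R[i] :=
  derive1 (fun t : R => complex.Re (f (x + t%:C *: v))) 0 +i*
  derive1 (fun t : R => complex.Im (f (x + t%:C *: v))) 0.

Definition ex (j : 'I_n) : Cn R n := delta_mx 0 j.
Definition ey (j : 'I_n) : Cn R n := 'i%C *: delta_mx 0 j.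

Definition dz j f x : R[i] := 2^-1 * (derR (ex j) f x - 'i%C * derR (ey j) f x).
Definition dzb j f x : R[i] := 2^-1 * (derR (ex j) f x + 'i%C * derR (ey j) f x).

(* f is of class C^k (in the real sense) on the open set U. *)
Fixpoint Ck (k : nat) U f : Prop :=
  (forall x, U x -> {for x, continuous (f : Cn R n -> (R[i])^o)}) /\
  (if k is k'.+1 then
     forall j v, v = ex j \/ v = ey j ->
       (forall x, U x -> derivableR v f x) /\ Ck k' U (derR v f)
   else True).

Definition smooth U f : Prop := forall k, Ck k U f.

Definition smoothV U (V : Cn R n -> Cn R n) : Prop :=
  forall j, smooth U (fun x => V x 0 j).

(* (ddbar f)(Z, Zbar) at x. *)
Definition ddbar f x (Z : Cn R n) : R[i] :=
  \sum_j \sum_k dz j (dzb k f) x * Z 0 j * conjc (Z 0 k).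

(* A complexified tangent vector of C^n: (a, b) stands for
   sum_j a_j d/dz_j + b_j d/dzbar_j. *)
Definition cvec : Type := (Cn R n * Cn R n)%type.
Definition cfield : Type := Cn R n -> cvec.

Definition conjV v : Cn R n := map_mx conjc v.
Definition cbar (u : cvec) : cvec := (conjV u.2, conjV u.1).
Definition Fbar (X : cfield) : cfield := fun x => cbar (X x).
Definition smoothF U (X : cfield) : Prop :=
  smoothV U (fst \o X) /\ smoothV U (snd \o X).

Definition cstF (u : cvec) : cfield := fun=> u.

Definition fder (X : cfield) f x : R[i] :=
  \sum_j ((X x).1 0 j * dz j f x + (X x).2 0 j * dzb j f x).
Definition fderV (X : cfield) (V : Cn R n -> Cn R n) x : Cn R n :=
  \row_j fder X (fun y => V y 0 j) x.
Definition bracket (X Y : cfield) : cfield := fun x =>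
  (fderV X (fst \o Y) x - fderV Y (fst \o X) x,
   fderV X (snd \o Y) x - fderV Y (snd \o X) x).

(* A connection on the trivialized bundle T^{1,0}: the k-th row of
   [conn_z G j x] (resp. [conn_zb G j x]) holds the components of the covariant
   derivative of d/dz_k along d/dz_j (resp. d/dzbar_j). *)
Record connection : Type := Connection {
  conn_z : 'I_n -> Cn R n -> 'M[R[i]]_n;
  conn_zb : 'I_n -> Cn R n -> 'M[R[i]]_n }.

Implicit Type G : connection.

Definition nabla G (X : cfield) (V : Cn R n -> Cn R n) : Cn R n -> Cn R n :=
  fun x => fderV X V x +
    V x *m \sum_j ((X x).1 0 j *: conn_z G j x + (X x).2 0 j *: conn_zb G j x).

(* The induced connection on the complexified tangent bundle; it commutes with
   conjugation, hence comes from a real connection on T(M). *)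
Definition nablaT G (X Y : cfield) : cfield := fun x =>
  (nabla G X (fst \o Y) x,
   conjV (nabla G (Fbar X) (fun y => conjV (Y y).2) x)).

Definition torsion G (X Y : cfield) : cfield := fun x =>
  nablaT G X Y x - nablaT G Y X x - bracket X Y x.

Definition curvature G (X Y : cfield) (V : Cn R n -> Cn R n) : Cn R n -> Cn R n :=
  fun x => nabla G X (nabla G Y V) x - nabla G Y (nabla G X V) x
           - nabla G (bracket X Y) V x.

(* sum_j theta^j (R(Z1, Zbar2) W_j) at x, for the frame W_j = d/dz_j. As the
   torsion and the curvature are tensors, vectors are extended by constants. *)
Definition Theta G x (Z1 Z2 : Cn R n) : R[i] :=
  \sum_j (curvature G (cstF (Z1, 0)) (cstF (0, conjV Z2)) (fun=> ex j) x) 0 j.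

(* tau phi, for the values phi of a 1-form at the point x. *)
Definition tau G x (phi : cvec -> R[i]) (u v : cvec) : R[i] :=
  phi (torsion G (cstF u) (cstF v) x).

(* <v, w> for the Gram matrix H = (<d/dz_j, d/dz_k>)_(j, k). *)
Definition herm (H : 'M[R[i]]_n) v w : R[i] :=
  \sum_j \sum_k v 0 j * H j k * conjc (w 0 k).

Definition flat (H : 'M[R[i]]_n) (Z : Cn R n) (u : cvec) : R[i] := herm H u.1 Z.

Definition orthonormal (H : 'M[R[i]]_n) (e : 'M[(R[i])^o]_n) : Prop :=
  forall j k, herm H (row j e) (row k e) = (j == k)%:R.

(* |omega|^2 for a (2,0)-form omega at a point. With theta dual to the
   orthonormal basis (e_j) of T^{1,0}, omega is the sum over j < k of
   omega(e_j, e_k) theta^j /\ theta^k. The sum of squares does not depend on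
   the orthonormal basis, and one is chosen. *)
Definition sqnorm2 (H : 'M[R[i]]_n) (omega : cvec -> cvec -> R[i]) : R[i] :=
  let e := xget 0 [set e | orthonormal H e] in
  \sum_(j < n) \sum_(k < n | (j < k)%N) `|omega (row j e, 0) (row k e, 0)| ^+ 2.

(* G is the Chern connection, over the open set U of C^n, of the Hermitian
   metric with Gram matrix h: its (0,1)-part is dbar, and it is compatible with
   the metric. *)
Definition is_chern U (h : Cn R n -> 'M[R[i]]_n) G : Prop :=
  (forall (X : cfield) (V : Cn R n -> Cn R n), smoothF U X -> smoothV U V ->
     forall x, U x -> (X x).1 = 0 -> nabla G X V x = fderV X V x) /\
  (forall (X : cfield) (V W : Cn R n -> Cn R n),
     smoothF U X -> smoothV U V -> smoothV U W ->
     forall x, U x ->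
       fder X (fun y => herm (h y) (V y) (W y)) x =
       herm (h x) (nabla G X V x) (W x) +
       herm (h x) (V x) (nabla G (Fbar X) W x)).

End Calculus.

(* The conditions of [is_chern] are satisfiable: with H the Gram matrix, the
   coefficients (dH/dz_j) H^-1 define a Chern connection. *)
Section ChernExistence.
Variables (R : realType) (n : nat).
Implicit Types (f g : Cn R n -> R[i]) (x v w : Cn R n).

Lemma derivableR_mul v f g x : derivableR v f x -> derivableR v g x ->
  derivableR v (fun y => f y * g y) x /\
  derR v (fun y => f y * g y) x = derR v f x * g x + f x * derR v g x.
Proof.
move=> [a1 a2] [b1 b2].
have ReM (z w : R[i]) : complex.Re (z * w) = complex.Re z * complex.Re w - complex.Im z * complex.Im w by case: z; case: w.
have ImM (z w : R[i]) : complex.Im (z * w) = complex.Re z * complex.Im w + complex.Im z * complex.Re w by case: z; case: w.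
have E1 : (fun t : R => complex.Re (f (x + t%:C *: v) * g (x + t%:C *: v))) =
  (fun t : R => complex.Re (f (x + t%:C *: v))) * (fun t : R => complex.Re (g (x + t%:C *: v)))
  - (fun t : R => complex.Im (f (x + t%:C *: v))) * (fun t : R => complex.Im (g (x + t%:C *: v))).
  by apply/funext => t; rewrite ReM.
have E2 : (fun t : R => complex.Im (f (x + t%:C *: v) * g (x + t%:C *: v))) =
  (fun t : R => complex.Re (f (x + t%:C *: v))) * (fun t : R => complex.Im (g (x + t%:C *: v)))
  + (fun t : R => complex.Im (f (x + t%:C *: v))) * (fun t : R => complex.Re (g (x + t%:C *: v))).
  by apply/funext => t; rewrite ImM.
split.
  split.
    rewrite E1.
    exact: (derivableB (derivableM a1 b1) (derivableM a2 b2)).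
  rewrite E2.
  exact: (derivableD (derivableM a1 b2) (derivableM a2 b1)).
rewrite /derR E1 E2 !derive1E.
rewrite (deriveB (derivableM a1 b1) (derivableM a2 b2)).
rewrite (deriveD (derivableM a1 b2) (derivableM a2 b1)).
rewrite (deriveM a1 b1) (deriveM a2 b2) (deriveM a1 b2) (deriveM a2 b1).
rewrite !scale0r !addr0.
move: (derive _ _ _) (derive _ _ _) (derive _ _ _) (derive _ _ _) => d1 d2 d3 d4.
case: (f x) => fa fb; case: (g x) => ga gb.
simpc => /=.
rewrite /GRing.scale /=.
by apply/eqP; rewrite eq_complex /=; apply/andP; split; apply/eqP; ring.
Qed.

Lemma derivableR_add v f g x : derivableR v f x -> derivableR v g x ->
  derivableR v (fun y => f y + g y) x /\
  derR v (fun y => f y + g y) x = derR v f x + derR v g x.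
Proof.
move=> [a1 a2] [b1 b2].
have E1 : (fun t : R => complex.Re (f (x + t%:C *: v) + g (x + t%:C *: v))) =
  (fun t : R => complex.Re (f (x + t%:C *: v))) + (fun t : R => complex.Re (g (x + t%:C *: v))).
  by apply/funext => t; rewrite raddfD.
have E2 : (fun t : R => complex.Im (f (x + t%:C *: v) + g (x + t%:C *: v))) =
  (fun t : R => complex.Im (f (x + t%:C *: v))) + (fun t : R => complex.Im (g (x + t%:C *: v))).
  by apply/funext => t; rewrite raddfD.
split.
  split; first by rewrite E1; exact: (derivableD a1 b1).
  by rewrite E2; exact: (derivableD a2 b2).
by rewrite /derR E1 E2 !derive1E (deriveD a1 b1) (deriveD a2 b2).
Qed.

Lemma derivableR_cst v (c : R[i]) x : derivableR v (fun=> c) x /\ derR v (fun=> c) x = 0.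
Proof.
split; first by split; apply: derivable_cst.
by rewrite /derR !derive1E !derive_cst.
Qed.

Lemma derivableR_conj v f x : derivableR v f x ->
  derivableR v (fun y => (conjc (f y))) x /\ derR v (fun y => (conjc (f y))) x = (conjc (derR v f x)).
Proof.
move=> [a b].
have E1 : (fun t : R => complex.Re (conjc (f (x + t%:C *: v)))) = (fun t : R => complex.Re (f (x + t%:C *: v))).
  by apply/funext => t; rewrite ?fctE; case: (f (x + t%:C *: v)).
have E2 : (fun t : R => complex.Im (conjc (f (x + t%:C *: v)))) = - (fun t : R => complex.Im (f (x + t%:C *: v))).
  by apply/funext => t; rewrite ?fctE; case: (f (x + t%:C *: v)).
split.
  split; first by rewrite E1.
  by rewrite E2; exact: (derivableN b).
by rewrite /derR E1 E2 !derive1E (deriveN b).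
Qed.

Definition dfb f x := forall j v, v = ex R j \/ v = ey R j -> derivableR v f x.

Lemma smooth_dfb (U : set (Cn R n)) f x : smooth U f -> U x -> dfb f x.
Proof. by move=> /(_ 1)[_ H] Ux j v /(H j)[+ _]; apply. Qed.

Lemma fder_mul X f g x : dfb f x -> dfb g x -> 
  dfb (fun y => f y * g y) x /\
  fder X (fun y => f y * g y) x = fder X f x * g x + f x * fder X g x.
Proof.
move=> df dg; split.
  by move=> j v vE; have [] := derivableR_mul (df _ _ vE) (dg _ _ vE).
rewrite /fder mulr_suml mulr_sumr -big_split; apply: eq_bigr => j _ /=.
have hx : ex R j = ex R j \/ ex R j = ey R j by left.
have hy : ey R j = ex R j \/ ey R j = ey R j by right.
rewrite /dz /dzb.
have [_ ->] := derivableR_mul (df _ _ hx) (dg _ _ hx).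
have [_ ->] := derivableR_mul (df _ _ hy) (dg _ _ hy).
set A := derR _ _ _; set B := derR _ _ _; set A' := derR _ _ _; set B' := derR _ _ _.
set u := _ 0 j; set u' := _ 0 j; rewrite /= in A B A' B' u u' *.
by ring.
Qed.

Lemma fder_add X f g x : dfb f x -> dfb g x -> 
  dfb (fun y => f y + g y) x /\
  fder X (fun y => f y + g y) x = fder X f x + fder X g x.
Proof.
move=> df dg; split.
  by move=> j v vE; have [] := derivableR_add (df _ _ vE) (dg _ _ vE).
rewrite /fder -big_split; apply: eq_bigr => j _ /=.
have hx : ex R j = ex R j \/ ex R j = ey R j by left.
have hy : ey R j = ex R j \/ ey R j = ey R j by right.
rewrite /dz /dzb.
have [_ ->] := derivableR_add (df _ _ hx) (dg _ _ hx).
have [_ ->] := derivableR_add (df _ _ hy) (dg _ _ hy).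
set A := derR _ _ _; set B := derR _ _ _; set A' := derR _ _ _; set B' := derR _ _ _.
set u := _ 0 j; set u' := _ 0 j; rewrite /= in A B A' B' u u' *.
by ring.
Qed.

Lemma fder_sum X (I : Type) (r : seq I) (F : I -> Cn R n -> R[i]) x :
  (forall i, dfb (F i) x) ->
  dfb (fun y => \sum_(i <- r) F i y) x /\
  fder X (fun y => \sum_(i <- r) F i y) x = \sum_(i <- r) fder X (F i) x.
Proof.
move=> H; elim: r => [|i r [IH1 IH2]].
  have -> : (fun y : Cn R n => \sum_(i <- [::]) F i y) = fun=> 0 by apply/funext => y; rewrite big_nil.
  rewrite big_nil; split; first by move=> j v _; have [] := derivableR_cst v 0 x.
  rewrite /fder big1 // => j _; rewrite /dz /dzb !(derivableR_cst _ _ _).2; ring.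
have -> : (fun y : Cn R n => \sum_(i <- i :: r) F i y) = fun y => F i y + \sum_(i <- r) F i y.
  by apply/funext => y; rewrite big_cons.
rewrite big_cons -IH2; exact: (fder_add X (H i) IH1).
Qed.

Lemma dz_conj f j x : dfb f x -> dz j (fun y => (conjc (f y))) x = conjc (dzb j f x)
  /\ dzb j (fun y => (conjc (f y))) x = conjc (dz j f x).
Proof.
move=> df.
have hx : ex R j = ex R j \/ ex R j = ey R j by left.
have hy : ey R j = ex R j \/ ey R j = ey R j by right.
rewrite /dz /dzb.
have [_ ->] := derivableR_conj (df _ _ hx).
have [_ ->] := derivableR_conj (df _ _ hy).
have E2 : (conjc (2^-1 : R[i])) = 2^-1 by rewrite fmorphV rmorph_nat.
have Ei : (conjc ('i%C : R[i])) = - 'i.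
  by apply/eqP; rewrite eq_complex /= oppr0 !eqxx.
move: (derR _ _ _) (derR _ _ _) => A B.
have EM (z w : R[i]) : (conjc (z * w)) = conjc z * conjc w by rewrite rmorphM.
have ED (z w : R[i]) : (conjc (z + w)) = conjc z + conjc w by rewrite rmorphD.
have EN (z : R[i]) : (conjc (- z)) = - conjc z by rewrite rmorphN.
by rewrite !EM !ED !EN !EM E2 Ei mulNr opprK.
Qed.

Lemma fder_conj X f x : dfb f x -> dfb (fun y => (conjc (f y))) x /\
  fder X (fun y => (conjc (f y))) x = (conjc (fder (Fbar X) f x)).
Proof.
move=> df; split; first by move=> j v /df/derivableR_conj[].
rewrite /fder rmorph_sum; apply: eq_bigr => j _ /=.
have [-> ->] := dz_conj j df.
by rewrite rmorphD !rmorphM /= /conjV !mxE !conjcK addrC.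
Qed.

Lemma der_near v f g x : (\forall y \near x, f y = g y) -> derR v f x = derR v g x.
Proof.
move=> H.
have L : (fun t : R => x + t%:C *: v) @ (0 : R) --> x.
  rewrite -[X in _ --> X]addr0; apply: cvgD; first exact: cvg_cst.
  rewrite -[X in _ --> X](scale0r v); apply: cvgZr_tmp.
  apply/cvgrPdist_lt => e e0.
  have [r0 re] : 0 < complex.Re e /\ e = (complex.Re e)%:C.
    by move: e0; case: (e) => ea eb; rewrite ltcE /= => /andP[/eqP -> ->].
  apply: filterS (@nbhs0_lt R R^o _ r0) => t h.
  by rewrite sub0r normrN re normc_def /= expr0n /= addr0 sqrtr_sqr ltcR.
have N : \forall t \near (0 : R), f (x + t%:C *: v) = g (x + t%:C *: v) by exact: (L _ H).
rewrite /derR !derive1E.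
by congr (_ +i* _); apply: near_eq_derive; apply: filterS N => t ->.
Qed.


Lemma dzb_near j f g x : (\forall y \near x, f y = g y) -> dzb j f x = dzb j g x.
Proof. by move=> H; rewrite /dzb !(der_near _ H). Qed.

Lemma hermDl (H : 'M[R[i]]_n) u v w : herm H (u + v) w = herm H u w + herm H v w.
Proof.
rewrite /herm -big_split; apply: eq_bigr => j _; rewrite /= -big_split; apply: eq_bigr => k _ /=.
by rewrite mxE !mulrDl.
Qed.
Lemma hermDr (H : 'M[R[i]]_n) u v w : herm H u (v + w) = herm H u v + herm H u w.
Proof.
rewrite /herm -big_split; apply: eq_bigr => j _; rewrite /= -big_split; apply: eq_bigr => k _ /=.
by rewrite mxE rmorphD mulrDr.
Qed.
Lemma hermMl (H A : 'M[R[i]]_n) v w : herm H (v *m A) w = herm (A *m H) v w.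
Proof.
rewrite /herm exchange_big [RHS]exchange_big; apply: eq_bigr => k _ /=.
rewrite -!mulr_suml; congr (_ * _).
transitivity ((v *m A *m H) 0 k); first by rewrite !mxE.
by rewrite -mulmxA mxE.
Qed.

Variables (U : set (Cn R n)) (h : Cn R n -> 'M[R[i]]_n).
Hypothesis oU : open U.
Hypothesis hs : forall j k, smooth U (fun x => h x j k).
Hypothesis hh : forall x, U x -> forall v w, herm (h x) w v = (conjc (herm (h x) v w)).
Hypothesis hp : forall x, U x -> forall v, v != 0 -> 0 < herm (h x) v v.

Definition Dh j x : 'M[R[i]]_n := \matrix_(a, b) dz j (fun y => h y a b) x.
Definition chernG : connection R n :=
  Connection (fun j x => Dh j x *m invmx (h x)) (fun _ _ => 0).

Lemma h_unit x : U x -> h x \in unitmx.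
Proof.
move=> Ux; rewrite -row_free_unit -kermx_eq0; apply/eqP/row_matrixP => i; rewrite row0.
apply/eqP; apply/negP => /negP N.
have := hp Ux N; set v := row i _.
have -> : herm (h x) v v = herm 1%:M (v *m h x) v by rewrite hermMl mulmx1.
have -> : v *m h x = 0 by rewrite -row_mul mulmx_ker row0.
by rewrite /herm big1 ?ltxx // => j _; rewrite big1 // => k _; rewrite mxE !mul0r.
Qed.

Lemma h_conj x j k : U x -> (conjc (h x j k)) = h x k j.
Proof.
move=> Ux.
have E a b : herm (h x) (ex R a) (ex R b) = h x a b.
  rewrite /herm (bigD1 a) //= [X in _ + X]big1 ?addr0; last first.
    by move=> i ia; rewrite big1 // => l _; rewrite mxE (negbTE ia) !mul0r.
  rewrite (bigD1 b) //= big1 ?addr0; last first.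
    by move=> i ia; rewrite !mxE (negbTE ia) conjc0 mulr0.
  by rewrite !mxE !eqxx mul1r conjc1 mulr1.
by rewrite -(E j k) -(hh Ux) E.
Qed.

Lemma chernP : is_chern U h chernG.
Proof.
split=> [X V sX sV x Ux X0|X V W [sX1 sX2] sV sW x Ux].
  rewrite /nabla big1 ?mulmx0 ?addr0 // => j _.
  by rewrite X0 mxE scale0r scaler0 addr0.
have dV j := smooth_dfb (sV j) Ux.
have dW j := smooth_dfb (sW j) Ux.
have dh j k := smooth_dfb (hs j k) Ux.
have dVh j k := (fder_mul X (dV j) (dh j k)).1.
have dWc k := fder_conj X (dW k).
rewrite /nabla hermDl hermDr hermMl.
have -> (A : 'M[R[i]]_n) :
    herm (h x) (V x) (W x *m A) = conjc (herm (A *m h x) (W x) (V x)).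
  by rewrite (hh Ux) hermMl.
have NA (c1 c2 : Cn R n) : (\sum_j (c1 0 j *: conn_z chernG j x + c2 0 j *: conn_zb chernG j x)) *m h x
   = \sum_j c1 0 j *: Dh j x.
  rewrite mulmx_suml; apply: eq_bigr => j _ /=.
  by rewrite scaler0 addr0 -scalemxAl mulmxKV // h_unit.
rewrite !NA.
have -> : fder X (fun y => herm (h y) (V y) (W y)) x =
  \sum_j \sum_k (fder X (fun y => V y 0 j) x * h x j k * (conjc (W x 0 k)) +
                 V x 0 j * fder X (fun y => h y j k) x * (conjc (W x 0 k)) +
                 V x 0 j * h x j k * (conjc (fder (Fbar X) (fun y => W y 0 k) x))).
  have T j k := fder_mul X (dVh j k) (dWc k).1.
  rewrite /herm (fder_sum X _ (fun j => (fder_sum X _ (fun k => (T j k).1)).1)).2.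
  apply: eq_bigr => j _; rewrite (fder_sum X _ (fun k => (T j k).1)).2.
  apply: eq_bigr => k _; rewrite (T j k).2 (fder_mul X (dV j) (dh j k)).2 (dWc k).2.
  by rewrite mulrDl.
have S2 : \sum_j \sum_k V x 0 j * fder X (fun y => h y j k) x * (conjc (W x 0 k)) =
   herm (\sum_j (X x).1 0 j *: Dh j x) (V x) (W x) +
   (conjc (herm (\sum_j (Fbar X x).1 0 j *: Dh j x) (W x) (V x))).
  rewrite /herm rmorph_sum /=.
  under [X in _ + X]eq_bigr do rewrite rmorph_sum /=.
  rewrite [X in _ + X]exchange_big -big_split; apply: eq_bigr => j _ /=.
  rewrite -big_split; apply: eq_bigr => k _ /=.
  have EM (z w : R[i]) : conjc (z * w) = conjc z * conjc w by rewrite rmorphM.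
  have -> : fder X (fun y => h y j k) x =
      (\sum_l (X x).1 0 l *: Dh l x) j k +
      conjc ((\sum_l (Fbar X x).1 0 l *: Dh l x) k j).
    rewrite !summxE rmorph_sum -big_split; apply: eq_bigr => l _ /=.
    have -> : (Fbar X x).1 0 l = conjc ((X x).2 0 l) by rewrite mxE.
    rewrite [LHS]/= !mxE EM conjcK; congr (_ + _ * _).
    rewrite -(dz_conj l (dh k j)).2.
    by apply: dzb_near; move: oU; rewrite openE => /(_ _ Ux);
       apply: filterS => y Uy; rewrite h_conj.
  rewrite !EM conjcK mulrDr mulrDl; congr (_ + _).
  by rewrite mulrC [in RHS]mulrC mulrCA mulrC.
have S1 : \sum_j \sum_k fder X (fun y => V y 0 j) x * h x j k * (conjc (W x 0 k)) =
   herm (h x) (fderV X V x) (W x).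
  by apply: eq_bigr => j _; apply: eq_bigr => k _; rewrite mxE.
have S3 : \sum_j \sum_k V x 0 j * h x j k * (conjc (fder (Fbar X) (fun y => W y 0 k) x)) =
   herm (h x) (V x) (fderV (Fbar X) W x).
  by apply: eq_bigr => j _; apply: eq_bigr => k _; rewrite mxE.
under eq_bigr do rewrite !big_split /=.
rewrite !big_split /= S1 S2 S3.
set a := herm _ _ _; set b := herm _ _ _; set c := herm _ _ _; set d := conjc _.
ring.
Qed.
End ChernExistence.

Section Manifold.
Variables (R : realType) (n : nat).

(* A homeomorphism [chmap] from the open set [chdom] onto an open set of C^n,
   with inverse [chinv]; both are extended arbitrarily to total functions. *)
Record chart (T : topologicalType) : Type := Chart {
  chdom : set T;
  chmap : T -> Cn R n;
  chinv : Cn R n -> T;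
  chdom_open : open chdom;
  chmap_open : open (chmap @` chdom);
  chmapK : forall p, chdom p -> chinv (chmap p) = p;
  chmap_continuous : forall p, chdom p -> {for p, continuous chmap};
  chinv_continuous : forall x, (chmap @` chdom) x -> {for x, continuous chinv} }.

Record complex_manifold : Type := ComplexManifold {
  carrier :> topologicalType;
  hausdorffM : hausdorff_space carrier;
  second_countableM : @second_countable carrier;
  atlas : set (chart carrier);
  atlas_cover : forall p : carrier, exists2 c, atlas c & chdom c p;
  atlas_holo : forall c c', atlas c -> atlas c' -> forall p, chdom c p -> chdom c' p ->
    differentiable (chmap c' \o chinv c) (chmap c p) }.

Variable M : complex_manifold.
Implicit Types (c : chart M) (Omega : set M) (rho : M -> R).

(* [gram h c x] is the matrix of the metric in the basis d/dz_j of the chart c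
   at the point with coordinates x; it is meaningful on the range of c. *)
Record hermitian_metric : Type := HermitianMetric {
  gram : chart M -> Cn R n -> 'M[R[i]]_n;
  gram_smooth : forall c, atlas c -> forall j k,
    smooth (chmap c @` chdom c) (fun x => gram c x j k);
  gram_herm : forall c, atlas c -> forall p, chdom c p -> forall v w,
    herm (gram c (chmap c p)) w v = conjc (herm (gram c (chmap c p)) v w);
  gram_pos : forall c, atlas c -> forall p, chdom c p -> forall v, v != 0 ->
    0 < herm (gram c (chmap c p)) v v;
  gram_compat : forall c c', atlas c -> atlas c' ->
    forall p, chdom c p -> chdom c' p -> forall v w,
    herm (gram c (chmap c p)) v w =
    herm (gram c' (chmap c' p)) ('d (chmap c' \o chinv c) (chmap c p) v)
                                ('d (chmap c' \o chinv c) (chmap c p) w) }.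

(* The fundamental form i sum_(j, k) h_jk dz_j /\ dzbar_k is closed; its
   (1,2)-part is the conjugate of its (2,1)-part. *)
Definition kaehler (h : hermitian_metric) : Prop :=
  forall c, atlas c -> forall x, (chmap c @` chdom c) x -> forall j k l,
    dz l (fun y => gram h c y j k) x = dz j (fun y => gram h c y l k) x.

(* D c holds the coefficients in the chart c; they are determined by h on the
   range of c, so no compatibility between charts has to be required. *)
Definition chern_connection (h : hermitian_metric) (D : chart M -> connection R n)
    : Prop :=
  forall c, atlas c -> is_chern (chmap c @` chdom c) (gram h c) (D c).

Definition C2_on Omega (f : M -> R) : Prop :=
  forall c, atlas c ->
    Ck 2 (chmap c @` (chdom c `&` Omega)) (fun x => (f (chinv c x))%:C).

Definition bdry Omega : set M := closure Omega `\` interior Omega.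

Definition relcompact_domain Omega : Prop :=
  [/\ open Omega, connected Omega, Omega !=set0 & compact (closure Omega)].

(* Near each boundary point, in suitable local coordinates, Omega lies on one
   side of the graph of a Lipschitz function, in the direction of a unit vector
   u. The class of the transition maps makes the choice of chart immaterial. *)
Definition lipschitz_boundary Omega : Prop :=
  forall p, bdry Omega p ->
  exists2 c, atlas c /\ chdom c p &
  exists (u : Cn R n) (gamma : Cn R n -> R),
  [/\ dotR u u = 1,
      exists K : R, forall x y, `|gamma x - gamma y| <= K * normR (x - y) &
      \forall q \near p, Omega q <->
        dotR (chmap c q) u < gamma (chmap c q - (dotR (chmap c q) u)%:C *: u)].

(* Lipschitz near every point; on compact sets this is the Lipschitz property
   for the distance of any Hermitian metric. *)
Definition lipschitzM rho : Prop :=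
  forall c p, atlas c -> chdom c p ->
  exists (K : R) (U : set M),
  [/\ nbhs p U, U `<=` chdom c &
      forall q r, U q -> U r -> `|rho q - rho r| <= K * normR (chmap c q - chmap c r)].

Definition bdry_dist Omega c (q : M) : R :=
  inf [set normR (chmap c q - chmap c r) | r in bdry Omega `&` chdom c].

(* The comparability of - rho with the distance to the boundary is expressed
   near each boundary point, with the Euclidean distance of local coordinates.
   For a relatively compact Omega it is the comparability on all of Omega with
   the distance of any Hermitian metric, by compactness of the closure. *)
Definition lipschitz_defining Omega rho : Prop :=
  [/\ lipschitzM rho,
      Omega = [set p | rho p < 0],
      forall p, bdry Omega p -> rho p = 0 &
      forall p c, bdry Omega p -> atlas c -> chdom c p ->
      exists A B : R, [/\ 0 < A, 0 < B &
        \forall q \near p, Omega q ->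
          A * bdry_dist Omega c q <= - rho q <= B * bdry_dist Omega c q]].

End Manifold.

(* Main.v *)
(* The curvature term of any Hermitian metric h is the curvature of the
   determinant bundle: with the Chern connection matrix (dh) h^-1 and Jacobi's
   formula, Theta = - ddbar log det h in every chart. Under a change of
   coordinates det h is multiplied by the squared modulus of a Jacobian, the same
   one for g and gt, so psi = log (det g / det gt) is a global smooth function,
   and Theta_M + ddbar psi = Theta_M~. The conclusion is then the hypothesis
   without its nonnegative torsion term. *)
Require Import Defs.
From HB Require Import structures.
From mathcomp Require Import all_boot all_order all_algebra perm.
From mathcomp Require Import complex.
From mathcomp Require Import all_classical all_reals all_analysis.
From mathcomp Require Import ring.
Import Order.TTheory GRing.Theory Num.Theory.
Import numFieldNormedType.Exports.
Local Open Scope classical_set_scope.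
Local Open Scope ring_scope.
Local Open Scope complex_scope.
Set Implicit Arguments.
Unset Strict Implicit.
Unset Printing Implicit Defensive.

(** Two obstacles shape the proof. The connections are known only through [is_chern], a condition on
    smooth fields, so their coefficients must first be recovered by testing on constant fields. And
    in the curvature of a holomorphic frame d/dz acts first and d/dzbar second, opposite to [ddbar];
    since [Ck] speaks of derivatives along coordinate directions only, the symmetry of second
    derivatives is derived by hand on real planes, from the mean value theorem. The independence of
    psi from the chart is a pointwise matter: at a given point both determinants change by the same
    number, which drops out of the difference of logarithms before anything is differentiated. Hence
    any choice of a chart around each point defines psi. As psi is built from the two metrics alone
    and the weight (-rho)^eta is left untouched, one psi serves both exponents. *)

(** * Closure properties of the class C^k under algebraic operations and the logarithm *)

Section DirectionalCalculus.
Variables (R : realType) (n : nat).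
Implicit Types (f g : Cn R n -> R[i]) (x v w : Cn R n) (U : set (Cn R n)).

Lemma complex_gt0 (e : R[i]) : 0 < e -> 0 < complex.Re e /\ e = (complex.Re e)%:C.
Proof. by case: e => p q; rewrite ltcE /= => /andP[/eqP -> ->]. Qed.

(** An additive map bounded by the modulus is 1-Lipschitz; this treats real and imaginary parts at
    once. *)
Lemma continuous_contraction (pr : R[i] -> R) : {morph pr : z w / z - w} ->
  (forall z, `|pr z|%:C <= `|z|) ->
  forall z : (R[i])^o, {for z, continuous (pr : (R[i])^o -> R)}.
Proof.
move=> prB pr1 z; have F : Filter (nbhs z) by exact: nbhs_filter.
apply/cvgrPdist_lt => e e0.
have e0' : (0 : R[i]) < e%:C by rewrite ltcR.
have H : \forall w \near z, `|z - w| < e%:C.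
  exact: (@cvgr_dist_lt _ _ _ (nbhs z) F id z (@cvg_id _ _) _ e0').
apply: (@filterS _ _ F _ _ _ H) => w; rewrite -ltcR; apply: le_lt_trans.
by rewrite -prB; exact: pr1.
Qed.

Lemma continuous_Re (z : (R[i])^o) :
  {for z, continuous ((fun w : (R[i])^o => complex.Re w) : (R[i])^o -> R)}.
Proof.
apply: continuous_contraction => [u w|[p q]]; first by rewrite raddfB.
by rewrite normc_def /= lecR -sqrtr_sqr ler_wsqrtr // lerDl sqr_ge0.
Qed.

Lemma continuous_Im (z : (R[i])^o) :
  {for z, continuous ((fun w : (R[i])^o => complex.Im w) : (R[i])^o -> R)}.
Proof.
apply: continuous_contraction => [u w|[p q]]; first by rewrite raddfB.
by rewrite normc_def /= lecR -sqrtr_sqr ler_wsqrtr // lerDr sqr_ge0.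
Qed.

Lemma continuous_real_complex (r : R) :
  {for r, continuous ((fun t => t%:C) : R -> (R[i])^o)}.
Proof.
have F : Filter (nbhs r) by exact: nbhs_filter.
apply/cvgrPdist_lt => e /complex_gt0 [e0 ->].
have H : \forall w \near r, `|r - w| < complex.Re e.
  exact: (@cvgr_dist_lt _ _ _ (nbhs r) F id r (@cvg_id _ _) _ e0).
apply: (@filterS _ _ F _ _ _ H) => w; rewrite -ltcR; apply: le_lt_trans.
by rewrite -raddfB /= normc_def /= expr0n addr0 sqrtr_sqr.
Qed.

Lemma continuous_line x v (t : R) :
  {for t, continuous ((fun s => x + s%:C *: v) : R -> Cn R n)}.
Proof.
apply: cvgD; first exact: cvg_cst.
by apply: cvgZr_tmp; exact: continuous_real_complex.
Qed.

Lemma near_line x v (P : Cn R n -> Prop) :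
  (\forall y \near x, P y) -> \forall t \near (0 : R), P (x + t%:C *: v).
Proof.
move=> H; have L : (fun t : R => x + t%:C *: v) @ (0 : R) --> x.
  have E0 : x + (0 : R)%:C *: v = x by rewrite scale0r addr0.
  by have := @continuous_line x v 0; rewrite /prop_for /continuous_at E0.
exact: (L _ H).
Qed.

Lemma near_derivableR v f g x : (\forall y \near x, f y = g y) ->
  derivableR v f x -> derivableR v g x.
Proof.
move=> /near_line - /(_ v) N [dr di].
by split; [move: dr|move: di]; apply: near_eq_derivable; apply: filterS N => t ->.
Qed.

Lemma near_open U f g x : open U -> (forall x, U x -> f x = g x) -> U x ->
  \forall y \near x, f y = g y.
Proof. by rewrite openE => oU fg /oU; apply: filterS. Qed.

Lemma continuous_ext U f g : open U -> (forall x, U x -> f x = g x) ->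
  (forall x, U x -> {for x, continuous (f : Cn R n -> (R[i])^o)}) ->
  forall x, U x -> {for x, continuous (g : Cn R n -> (R[i])^o)}.
Proof.
move=> oU fg cf x Ux; have F : Filter (nbhs x) by exact: nbhs_filter.
move: (cf x Ux); rewrite /prop_for /continuous_at fg //; apply: cvg_trans.
apply: near_eq_cvg; exact: (near_open oU fg Ux).
Qed.

(** Derivatives at a point of an open set see only the germ there. This replaces functional
    extensionality throughout: formulas for metrics and connections hold only on the range of a
    chart. *)
Lemma Ck_ext k U f g : open U -> (forall x, U x -> f x = g x) ->
  Ck k U f -> Ck k U g.
Proof.
move=> oU; elim: k f g => [|k IH] f g fg; first by move=> [/(continuous_ext oU fg)].
move=> [/(continuous_ext oU fg) cg df]; split=> // j v vE.
have [df1 df2] := df j v vE; split.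
  by move=> x Ux; exact: near_derivableR (near_open oU fg Ux) (df1 x Ux).
by apply: IH df2 => x Ux; apply: der_near; exact: (near_open oU fg Ux).
Qed.

Lemma CkS k U f : Ck k.+1 U f -> Ck k U f.
Proof.
elim: k f => [|k IH] f [cf df]; first by split; [exact: cf|exact: I].
split; first exact: cf.
by move=> j v vE; have [d1 d2] := df j v vE; split; [exact: d1|exact: IH].
Qed.

Lemma Ck_dfb k U f x : Ck k.+1 U f -> U x -> dfb f x.
Proof. by move=> [_ df] Ux j v /(df j)[+ _]; apply. Qed.

Lemma Ck_cst k U (c : R[i]) : Ck k U (fun=> c).
Proof.
have cc (d : R[i]) x : {for x, continuous ((fun=> d) : Cn R n -> (R[i])^o)}.
  by have F : Filter (nbhs x) by [exact: nbhs_filter]; exact: cvg_cst.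
elim: k c => [|k IH] c; split; [by move=> x _; exact: cc|exact: I|by move=> x _; exact: cc|].
move=> j v _; split; first by move=> x _; exact: (derivableR_cst v c x).1.
have -> : derR v (fun=> c) = fun=> 0.
  by apply/funext => x; rewrite (derivableR_cst v c x).2.
exact: IH.
Qed.

Lemma CkD k U f g : open U -> Ck k U f -> Ck k U g -> Ck k U (fun x => f x + g x).
Proof.
move=> oU.
have cD f' g' x : {for x, continuous (f' : Cn R n -> (R[i])^o)} ->
    {for x, continuous (g' : Cn R n -> (R[i])^o)} ->
    {for x, continuous ((fun y => f' y + g' y) : Cn R n -> (R[i])^o)}.
  move=> cf cg; have F : Filter (nbhs x) by exact: nbhs_filter.
  exact: (@cvgD _ (R[i])^o _ _ F _ _ _ _ cf cg).
elim: k f g => [|k IH] f g [cf df] [cg dg].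
  by split; [move=> x Ux; exact: cD (cf x Ux) (cg x Ux)|exact: I].
split; first by move=> x Ux; exact: cD (cf x Ux) (cg x Ux).
move=> j v vE; have [df1 df2] := df j v vE; have [dg1 dg2] := dg j v vE.
split; first by move=> x Ux; exact: (derivableR_add (df1 x Ux) (dg1 x Ux)).1.
apply: (Ck_ext oU _ (IH _ _ df2 dg2)) => x Ux.
by rewrite (derivableR_add (df1 x Ux) (dg1 x Ux)).2.
Qed.

Lemma CkM k U f g : open U -> Ck k U f -> Ck k U g -> Ck k U (fun x => f x * g x).
Proof.
move=> oU.
have cM f' g' x : {for x, continuous (f' : Cn R n -> (R[i])^o)} ->
    {for x, continuous (g' : Cn R n -> (R[i])^o)} ->
    {for x, continuous ((fun y => f' y * g' y) : Cn R n -> (R[i])^o)}.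
  move=> cf cg; have F : Filter (nbhs x) by exact: nbhs_filter.
  exact: (@cvgM R[i] _ _ F _ _ _ _ cf cg).
elim: k f g => [|k IH] f g Cf Cg; move: (Cf) (Cg) => [cf df] [cg dg].
  by split; [move=> x Ux; exact: cM (cf x Ux) (cg x Ux)|exact: I].
split; first by move=> x Ux; exact: cM (cf x Ux) (cg x Ux).
move=> j v vE; have [df1 df2] := df j v vE; have [dg1 dg2] := dg j v vE.
split; first by move=> x Ux; exact: (derivableR_mul (df1 x Ux) (dg1 x Ux)).1.
have C := CkD oU (IH _ _ df2 (CkS Cg)) (IH _ _ (CkS Cf) dg2).
apply: (Ck_ext oU _ C) => x Ux.
by rewrite (derivableR_mul (df1 x Ux) (dg1 x Ux)).2.
Qed.

Lemma CkN k U f : open U -> Ck k U f -> Ck k U (fun x => - f x).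
Proof.
move=> oU Cf; apply: (Ck_ext oU _ (CkM oU (Ck_cst k U (-1)) Cf)) => x _.
by rewrite mulN1r.
Qed.

Lemma Ck_sum k U (I : Type) (r : seq I) (F : I -> Cn R n -> R[i]) : open U ->
  (forall i, Ck k U (F i)) -> Ck k U (fun x => \sum_(i <- r) F i x).
Proof.
move=> oU CF; elim: r => [|i r IH].
  by apply: (Ck_ext oU _ (Ck_cst k U 0)) => x _; rewrite big_nil.
by apply: (Ck_ext oU _ (CkD oU (CF i) IH)) => x _; rewrite big_cons.
Qed.

Lemma Ck_prod k U (I : Type) (r : seq I) (F : I -> Cn R n -> R[i]) : open U ->
  (forall i, Ck k U (F i)) -> Ck k U (fun x => \prod_(i <- r) F i x).
Proof.
move=> oU CF; elim: r => [|i r IH].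
  by apply: (Ck_ext oU _ (Ck_cst k U 1)) => x _; rewrite big_nil.
by apply: (Ck_ext oU _ (CkM oU (CF i) IH)) => x _; rewrite big_cons.
Qed.

Lemma Ck_det k U m (A : Cn R n -> 'M[R[i]]_m) : open U ->
  (forall i j, Ck k U (fun x => A x i j)) -> Ck k U (fun x => \det (A x)).
Proof.
move=> oU CA; apply: Ck_sum => // s; apply: CkM => //; first exact: Ck_cst.
exact: Ck_prod.
Qed.

(** Along the line [x + t v] this is the one-variable chain rule for the real part; the imaginary
    part is constantly zero. *)
Lemma derR_comp v (r : Cn R n -> R) (phi : R -> R) (d : R) x :
  derivableR v (fun y => (r y)%:C) x -> is_derive (r x) 1 phi d ->
  derivableR v (fun y => (phi (r y))%:C) x /\
  derR v (fun y => (phi (r y))%:C) x = d%:C * derR v (fun y => (r y)%:C) x.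
Proof.
move=> [dr _] dphi.
have {}dr : derivable (fun t : R => r (x + t%:C *: v)) 0 1 by [].
have dphi' : is_derive (r (x + (0 : R)%:C *: v)) 1 phi d.
  by rewrite scale0r addr0.
have D := @is_derive1_comp R phi (fun t : R => r (x + t%:C *: v)) 0 d _ dphi'
  (derivableP dr).
split; first by split; [exact: ex_derive|exact: derivable_cst].
rewrite /derR /= !derive1E !derive_cst (@derive_val _ _ _ _ _ _ _ D).
by apply/eqP; rewrite eq_complex /= !(mul0r, mulr0) subr0 addr0 !eqxx.
Qed.

Lemma continuous_comp_real (r : Cn R n -> R) (phi : R -> R) x :
  {for x, continuous ((fun y => (r y)%:C) : Cn R n -> (R[i])^o)} ->
  derivable phi (r x) 1 ->
  {for x, continuous ((fun y => (phi (r y))%:C) : Cn R n -> (R[i])^o)}.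
Proof.
move=> cr /derivable1_diffP /differentiable_continuous cphi.
have cr' : {for x, continuous r}.
  exact: (@continuous_comp _ _ _ (fun y => (r y)%:C : (R[i])^o)
    (fun w : (R[i])^o => complex.Re w) x cr (@continuous_Re _)).
apply: (@continuous_comp _ _ _ (phi \o r) (fun t => t%:C : (R[i])^o)).
  exact: (@continuous_comp _ _ _ r phi).
exact: continuous_real_complex.
Qed.

(** The derivative -(1/r)(1/r) r' again involves 1/r, now needed to one order less, so the induction
    on [k] closes. *)
Lemma CkV_real k U (r : Cn R n -> R) : open U -> (forall x, U x -> r x != 0) ->
  Ck k U (fun x => (r x)%:C) -> Ck k U (fun x => (r x)^-1%:C).
Proof.
move=> oU r0; have dV x (Ux : U x) := is_deriveV (r0 x Ux) (is_derive_id (r x) (1 : R)).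
have cV : (forall x, U x -> {for x, continuous ((fun y => (r y)%:C) : Cn R n -> (R[i])^o)}) ->
    forall x, U x -> {for x, continuous ((fun y => (r y)^-1%:C) : Cn R n -> (R[i])^o)}.
  move=> cr x Ux; apply: (continuous_comp_real (cr x Ux)).
  exact: (@ex_derive _ _ _ _ _ _ _ (dV x Ux)).
elim: k => [|k IH] Cr; move: (Cr) => [cr dr]; first by split; [exact: cV|exact: I].
split; first exact: cV.
move=> j v vE; have [d1 d2] := dr j v vE.
split; first by move=> x Ux; exact: (derR_comp (d1 x Ux) (dV x Ux)).1.
have CV := IH (CkS Cr).
apply: (Ck_ext oU _ (CkM oU (CkN oU (CkM oU CV CV)) d2)) => x Ux.
rewrite (derR_comp (d1 x Ux) (dV x Ux)).2; congr (_ * _).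
by rewrite /GRing.scale /= mulr1 expr2 invfM -rmorphM -rmorphN.
Qed.

(** Squaring makes the logarithm available for either sign of [r], and the factor 1/2 cancels the 2
    coming from the square. *)
Lemma is_derive_ln_sqr (r : R) : r != 0 ->
  is_derive r 1 (fun t => 2^-1 * ln (t ^+ 2)) r^-1.
Proof.
move=> r0; have r2 : 0 < r ^+ 2 by rewrite lt_def sqrf_eq0 r0 sqr_ge0.
have D1 : is_derive r 1 (fun t : R => t ^+ 2) (2 * r).
  by apply: is_derive_eq; rewrite /GRing.scale /=; ring.
have D2 := @is_derive1_comp R (@ln R) (fun t => t ^+ 2) r _ _ (is_derive1_ln r2) D1.
apply: (is_derive_eq (is_deriveZ 2^-1 D2)).
rewrite /GRing.scale /=; field; exact: r0.
Qed.

(** A single differentiation removes the logarithm and leaves (1/r) r', which [CkV_real] and [CkM]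
    handle without induction. *)
Lemma Ck_ln_sqr k U (r : Cn R n -> R) : open U -> (forall x, U x -> r x != 0) ->
  Ck k U (fun x => (r x)%:C) -> Ck k U (fun x => (2^-1 * ln (r x ^+ 2))%:C).
Proof.
move=> oU r0; have dl x (Ux : U x) := is_derive_ln_sqr (r0 x Ux).
have cl : (forall x, U x -> {for x, continuous ((fun y => (r y)%:C) : Cn R n -> (R[i])^o)}) ->
    forall x, U x -> {for x, continuous
      ((fun y => (2^-1 * ln (r y ^+ 2))%:C) : Cn R n -> (R[i])^o)}.
  move=> cr x Ux; apply: (continuous_comp_real (phi := fun t => 2^-1 * ln (t ^+ 2)) (cr x Ux)).
  exact: (@ex_derive _ _ _ _ _ _ _ (dl x Ux)).
case: k => [|k] Cr; move: (Cr) => [cr dr]; first by split; [exact: cl|exact: I].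
split; first exact: cl.
move=> j v vE; have [d1 d2] := dr j v vE.
split; first by move=> x Ux; exact: (derR_comp (d1 x Ux) (dl x Ux)).1.
have CV := CkV_real oU r0 (CkS Cr).
apply: (Ck_ext oU _ (CkM oU CV d2)) => x Ux.
by rewrite (derR_comp (d1 x Ux) (dl x Ux)).2.
Qed.

Lemma dz_ln_sqr j (r : Cn R n -> R) x :
  r x != 0 -> dfb (fun y => (r y)%:C) x ->
  dz j (fun y => (2^-1 * ln (r y ^+ 2))%:C) x =
  (r x)^-1%:C * dz j (fun y => (r y)%:C) x.
Proof.
move=> r0 dr; have hx := dr j _ (or_introl erefl); have hy := dr j _ (or_intror erefl).
have D := is_derive_ln_sqr r0.
have [_ Ex] := derR_comp hx D; have [_ Ey] := derR_comp hy D.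
rewrite /dz Ex Ey; move: (derR _ _ _) (derR _ _ _) => A B.
by rewrite [RHS]mulrCA; congr (_ * _); rewrite mulrBr [X in _ - X]mulrCA.
Qed.

End DirectionalCalculus.

(** * Symmetry of mixed second derivatives *)

Section Schwarz.
Variable R : realType.

(** The mean value theorem is applied twice: in the first variable to the increment s |-> u s h - u
    s 0, then in the second variable to [us s] at the intermediate point [s] so found. *)
Lemma double_increment (u us ust : R -> R -> R) (r h : R) : 0 < h -> h < r ->
  (forall s t : R, `|s| < r -> `|t| < r -> is_derive s 1 (u^~ t) (us s t)) ->
  (forall s t : R, `|s| < r -> `|t| < r -> is_derive t 1 (us s) (ust s t)) ->
  exists s t, [/\ `|s| < h, `|t| < h &
    (u h h - u h 0) - (u 0 h - u 0 0) = ust s t * h * h].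
Proof.
move=> h0 hr us' ust'.
have cc (f df : R -> R) :
    (forall x : R, x \in `[0, h] -> is_derive x 1 f (df x)) ->
    exists2 c, c \in `]0, h[ & f h - f 0 = df c * h.
  move=> D.
  have D1 x : x \in `]0, h[ -> is_derive x 1 f (df x).
    by move=> xh; apply: D; exact: subset_itv_oo_cc.
  have C : {within `[0, h], continuous f}.
    apply: derivable_within_continuous => x xh.
    exact: (@ex_derive _ _ _ _ _ _ _ (D x xh)).
  by have [c ch E] := MVT h0 D1 C; exists c => //; rewrite E subr0.
have nh x : x \in `[0, h] -> `|x| < r.
  by rewrite in_itv /= => /andP[x0 xh]; rewrite ger0_norm // (le_lt_trans xh).
have ph x : x \in `]0, h[ -> `|x| < h.
  by rewrite in_itv /= => /andP[x0 xh]; rewrite gtr0_norm.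
have nh0 : `|0 : R| < r by rewrite normr0 (lt_trans h0).
have nhh : `|h| < r by rewrite gtr0_norm.
have [s sh E1] := cc (fun s => u s h - u s 0) (fun s => us s h - us s 0)
  (fun s sh => is_deriveB (us' s h (nh s sh) nhh) (us' s 0 (nh s sh) nh0)).
have sr : `|s| < r by exact: lt_trans (ph _ sh) hr.
have [t th E2] := cc (us s) (ust s) (fun t th => ust' s t sr (nh t th)).
by exists s, t; split; [exact: ph|exact: ph|rewrite E1 E2].
Qed.

(** The double increment over a small square is h^2 times a value of either mixed derivative near
    the origin; continuity at the origin then identifies the two. *)
Lemma schwarz_plane (u us ut ust uts : R -> R -> R) (r : R) : 0 < r ->
  (forall s t : R, `|s| < r -> `|t| < r -> is_derive s 1 (u^~ t) (us s t)) ->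
  (forall s t : R, `|s| < r -> `|t| < r -> is_derive t 1 (u s) (ut s t)) ->
  (forall s t : R, `|s| < r -> `|t| < r -> is_derive t 1 (us s) (ust s t)) ->
  (forall s t : R, `|s| < r -> `|t| < r -> is_derive s 1 (ut^~ t) (uts s t)) ->
  (forall e, 0 < e -> exists2 d, 0 < d & forall s t, `|s| < d -> `|t| < d ->
     `|ust 0 0 - ust s t| < e /\ `|uts 0 0 - uts s t| < e) ->
  ust 0 0 = uts 0 0.
Proof.
move=> r0 us' ut' ust' uts' cont; apply/eqP/negPn/negP => ne.
(* Half the supposed gap: two errors below it add up to less than the gap, against the triangle
   inequality. *)
have e0 : 0 < `|ust 0 0 - uts 0 0| / 2 by rewrite divr_gt0 // normr_gt0 subr_eq0.
have [d d0 H] := cont _ e0.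
pose h := Num.min d r / 2.
have m0 : 0 < Num.min d r by rewrite lt_min d0.
have h0 : 0 < h by rewrite divr_gt0.
have hm : h < Num.min d r by rewrite ltr_pdivrMr // ltr_pMr // ltr1n.
have hd : h < d by rewrite (lt_le_trans hm) // ge_min lexx.
have hr : h < r by rewrite (lt_le_trans hm) // ge_min lexx orbT.
have [s [t [sh th E1]]] := double_increment h0 hr us' ust'.
(* With the variables exchanged the double increment is the same number, so the two intermediate
   values agree once h * h is cancelled. *)
have [t' [s' [t'h s'h E2]]] := @double_increment (fun t s => u s t)
  (fun t s => ut s t) (fun t s => uts s t) r h h0 hr
  (fun t s tr sr => ut' s t sr tr) (fun t s tr sr => uts' s t sr tr).
have E : ust s t = uts s' t'.
  apply: (mulIf (lt0r_neq0 h0)); apply: (mulIf (lt0r_neq0 h0)).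
  by rewrite -E1 -E2; ring.
have [H1 _] := H s t (lt_trans sh hd) (lt_trans th hd).
have [_ H2] := H s' t' (lt_trans s'h hd) (lt_trans t'h hd).
have := ltrD H1 H2; rewrite -splitr E [in X in _ + X]distrC => H3.
have := le_lt_trans (ler_normD _ _) H3.
by rewrite [X in `|X|](_ : _ = ust 0 0 - uts 0 0) ?ltxx //; ring.
Qed.

(** [derR] always differentiates at parameter 0 after moving the base point; this converts it into a
    derivative at an arbitrary parameter of a fixed line. *)
Lemma is_derive_shift (phi : R -> R) (s : R) :
  derivable (fun t => phi (s + t)) 0 1 ->
  is_derive s 1 phi (derive1 (fun t => phi (s + t)) 0).
Proof.
move=> D; have E : phi = (fun t => phi (s + t)) \o (fun t => t - s).
  by apply/funext => t /=; rewrite addrC subrK.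
have D1 : is_derive s 1 (fun t : R => t - s) 1.
  by apply: is_derive_eq; rewrite subr0.
have D2 : is_derive (s - s) 1 (fun t => phi (s + t)) (derive1 (fun t => phi (s + t)) 0).
  by rewrite subrr derive1E; exact/derivableP.
have := @is_derive1_comp R _ (fun t => t - s) s _ _ D2 D1.
by rewrite mulr1 -E.
Qed.

Variable n : nat.
Implicit Types (f g : Cn R n -> R[i]) (x v w : Cn R n) (U : set (Cn R n)).

Lemma near_box x v w (P : Cn R n -> Prop) : (\forall y \near x, P y) ->
  exists2 d : R, 0 < d & forall s t : R, `|s| < d -> `|t| < d ->
    P (x + s%:C *: v + t%:C *: w).
Proof.
move=> H.
have L : (fun p : R * R => x + p.1%:C *: v + p.2%:C *: w) @ (0 : R, 0 : R) --> x.
  have E0 : x + (0 : R)%:C *: v + (0 : R)%:C *: w = x by rewrite !scale0r !addr0.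
  rewrite -[X in _ --> X]E0; apply: cvgD; first apply: cvgD; first exact: cvg_cst.
    apply: cvgZr_tmp; apply: (@continuous_comp _ _ _ (fst : R * R -> R)
      (fun t : R => t%:C : (R[i])^o) (0, 0)).
      exact: cvg_fst.
    exact: continuous_real_complex.
  apply: cvgZr_tmp; apply: (@continuous_comp _ _ _ (snd : R * R -> R)
      (fun t : R => t%:C : (R[i])^o) (0, 0)).
    exact: cvg_snd.
  exact: continuous_real_complex.
have /nbhs_ballP [d d0 Hd] : nbhs (0 : R, 0 : R)
    (fun p : R * R => P (x + p.1%:C *: v + p.2%:C *: w)).
  exact: (L _ H).
exists d => // s t sd td; apply: (Hd (s, t)); split; rewrite /ball /= sub0r normrN //.
Qed.

(** [pr] stands for the real or the imaginary part: [derR] is defined componentwise, so the real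
    theorem is applied to each, on the plane through [x] spanned by [v] and [w]. *)
Lemma schwarz_proj (pr : R[i] -> R) U f x v w :
  (forall z : (R[i])^o, {for z, continuous (pr : (R[i])^o -> R)}) ->
  (forall v g y, derivableR v g y ->
     derivable (fun t : R => pr (g (y + t%:C *: v))) 0 1 /\
     pr (derR v g y) = derive1 (fun t : R => pr (g (y + t%:C *: v))) 0) ->
  open U -> Ck 2 U f -> U x ->
  (exists j, v = ex R j \/ v = ey R j) -> (exists j, w = ex R j \/ w = ey R j) ->
  pr (derR w (derR v f) x) = pr (derR v (derR w f) x).
Proof.
move=> prc prd oU [_ df] Ux [j vE] [l wE].
have [df1 [_ ddf]] := df j v vE; have [df1' [_ ddf']] := df l w wE.
have [d1 [c1 _]] := ddf l w wE; have [d2 [c2 _]] := ddf' j v vE.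
pose pt (s t : R) := x + s%:C *: v + t%:C *: w.
have pt0 : pt 0 0 = x by rewrite /pt !scale0r !addr0.
have [r r0 rU] : exists2 d : R, 0 < d & forall s t : R, `|s| < d -> `|t| < d -> U (pt s t).
  by apply: near_box; move: oU; rewrite openE => /(_ _ Ux).
have Dv g : (forall y, U y -> derivableR v g y) -> forall s t : R, `|s| < r -> `|t| < r ->
    is_derive s 1 (fun s => pr (g (pt s t))) (pr (derR v g (pt s t))).
  move=> dg s t sr tr; have [D ->] := prd v g _ (dg _ (rU s t sr tr)).
  have E : (fun t0 : R => pr (g (pt s t + t0%:C *: v))) = (fun t0 => pr (g (pt (s + t0) t))).
    apply/funext => t0; apply: (congr1 (fun y => pr (g y))); rewrite /pt.
    have -> : (s + t0)%:C = s%:C + t0%:C :> R[i] by rewrite rmorphD.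
    by rewrite scalerDl addrA [LHS]addrAC.
  by move: D; rewrite E => D; exact: (is_derive_shift (phi := fun s => pr (g (pt s t)))).
have Dw g : (forall y, U y -> derivableR w g y) -> forall s t : R, `|s| < r -> `|t| < r ->
    is_derive t 1 (fun t => pr (g (pt s t))) (pr (derR w g (pt s t))).
  move=> dg s t sr tr; have [D ->] := prd w g _ (dg _ (rU s t sr tr)).
  have E : (fun t0 : R => pr (g (pt s t + t0%:C *: w))) = (fun t0 => pr (g (pt s (t + t0)))).
    apply/funext => t0; apply: (congr1 (fun y => pr (g y))); rewrite /pt.
    have -> : (t + t0)%:C = t%:C + t0%:C :> R[i] by rewrite rmorphD.
    by rewrite scalerDl addrA.
  by move: D; rewrite E => D; exact: (is_derive_shift (phi := fun t => pr (g (pt s t)))).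
have near_pr g e : 0 < e -> {for x, continuous (g : Cn R n -> (R[i])^o)} ->
    \forall y \near x, `|pr (g x) - pr (g y)| < e.
  move=> e0 cg; have F : Filter (nbhs x) by exact: nbhs_filter.
  have C := @continuous_comp _ _ _ (g : Cn R n -> (R[i])^o) pr x cg (prc _).
  exact: (@cvgr_dist_lt _ _ _ (nbhs x) F (pr \o g) _ C _ e0).
have H := @schwarz_plane (fun s t => pr (f (pt s t)))
  (fun s t => pr (derR v f (pt s t))) (fun s t => pr (derR w f (pt s t)))
  (fun s t => pr (derR w (derR v f) (pt s t)))
  (fun s t => pr (derR v (derR w f) (pt s t))) r r0
  (Dv f df1) (Dw f df1') (Dw _ d1) (Dv _ d2).
cbv beta in H; rewrite pt0 in H; apply: H => e e0.
have [p p0 Hp] := near_box v w (near_pr _ _ e0 (c1 x Ux)).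
have [q q0 Hq] := near_box v w (near_pr _ _ e0 (c2 x Ux)).
exists (Num.min p q) => [|s t]; first by rewrite lt_min p0.
by rewrite !lt_min => /andP[sp sq] /andP[tp tq]; split; [exact: Hp|exact: Hq].
Qed.

Lemma derR_comm U f x v w : open U -> Ck 2 U f -> U x ->
  (exists j, v = ex R j \/ v = ey R j) -> (exists j, w = ex R j \/ w = ey R j) ->
  derR w (derR v f) x = derR v (derR w f) x.
Proof.
move=> oU Cf Ux vE wE; apply/eqP; rewrite eq_complex; apply/andP; split; apply/eqP.
  apply: (@schwarz_proj (fun z => complex.Re z) U f x v w) => // [z|v' g y [D _]].
    exact: continuous_Re.
  by [].
apply: (@schwarz_proj (fun z => complex.Im z) U f x v w) => // [z|v' g y [_ D]].
  exact: continuous_Im.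
by [].
Qed.

End Schwarz.

(** * Derivatives of products and determinants, and commutation of d/dz with d/dzbar *)

Section DeterminantDerivative.
Variables (R : realType) (n : nat).
Implicit Types (f g : Cn R n -> R[i]) (x v w : Cn R n) (U : set (Cn R n)).

Lemma fder_near X f g x : (\forall y \near x, f y = g y) -> fder X f x = fder X g x.
Proof.
move=> N; rewrite /fder; apply: eq_bigr => j _.
by rewrite /dz /dzb !(der_near _ N).
Qed.

Lemma fder_cst X (c : R[i]) x : fder X (fun=> c) x = 0.
Proof.
rewrite /fder big1 // => j _; rewrite /dz /dzb !(derivableR_cst _ _ _).2.
by rewrite !(mulr0, subr0, addr0).
Qed.

Lemma dfb_cst (c : R[i]) x : dfb (fun=> c) x.
Proof. by move=> j v _; exact: (derivableR_cst v c x).1. Qed.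

Lemma fder_scale X f (c : R[i]) x : dfb f x -> fder X (fun y => c * f y) x = c * fder X f x.
Proof.
by move=> df; rewrite (fder_mul X (dfb_cst c x) df).2 fder_cst mul0r add0r.
Qed.

(** The differentiated factor is singled out by the test [k == i], which hits exactly one factor
    because the list has no repetition. *)
Lemma fder_prod X (I : eqType) (r : seq I) (F : I -> Cn R n -> R[i]) x :
  uniq r -> (forall i, dfb (F i) x) ->
  dfb (fun y => \prod_(i <- r) F i y) x /\
  fder X (fun y => \prod_(i <- r) F i y) x =
  \sum_(i <- r) \prod_(k <- r) (if k == i then fder X (F k) x else F k x).
Proof.
move=> + dF; elim: r => [_|i r IH /= /andP[ir ur]].
  have -> : (fun y : Cn R n => \prod_(i <- [::]) F i y) = fun=> 1.
    by apply/funext => y; rewrite big_nil.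
  by rewrite big_nil fder_cst; split=> //; exact: dfb_cst.
have [d1 d2] := IH ur.
have -> : (fun y => \prod_(k <- i :: r) F k y) = fun y => F i y * \prod_(k <- r) F k y.
  by apply/funext => y; rewrite big_cons.
have [dm ->] := fder_mul X (dF i) d1.
split; first exact: dm.
rewrite big_cons big_cons eqxx d2 mulr_sumr; congr (_ * _ + _).
  by apply: eq_big_seq => k kr; case: eqP kr ir => // -> ->.
apply: eq_big_seq => k kr; rewrite big_cons; congr (_ * _).
by case: eqP kr ir => // -> ->.
Qed.

(* Jacobi's formula: the derivative of the determinant is obtained by
   differentiating one row at a time, then expanding along that row. *)
Lemma fder_det X m (A : Cn R n -> 'M[R[i]]_m) x :
  (forall i j, dfb (fun y => A y i j) x) ->
  fder X (fun y => \det (A y)) x =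
  \tr ((\matrix_(i, j) fder X (fun y => A y i j) x) *m \adj (A x)).
Proof.
move=> dA; pose dM := \matrix_(i, j) fder X (fun y => A y i j) x.
have dP (s : {perm 'I_m}) := fder_prod X (index_enum_uniq 'I_m) (fun i => dA i (s i)).
have dS (s : {perm 'I_m}) :=
  fder_mul X (dfb_cst ((-1) ^+ s) x) (dP s).1.
rewrite /determinant (fder_sum X _ (fun s => (dS s).1)).2.
under eq_bigr => s _ do rewrite (dS s).2 fder_cst mul0r add0r (dP s).2 mulr_sumr.
rewrite exchange_big; apply: eq_bigr => i _ /=.
pose B := \matrix_(k, l) (if k == i then dM k l else A x k l).
transitivity (\det B).
  apply: eq_bigr => s _; congr (_ * _); apply: eq_bigr => k _.
  by rewrite !mxE; case: eqP.
rewrite (expand_det_row B i) [RHS]mxE; apply: eq_bigr => j _.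
rewrite [B i j]mxE eqxx [\adj _ _ _]mxE; congr (_ * _).
rewrite /cofactor; congr (_ * \det _); apply/matrixP => k l.
by rewrite !mxE -[lift i k == i]negbK eq_sym neq_lift.
Qed.

(** With a Wirtinger derivative seen as the derivation along a constant field, the rules for [fder]
    (sums, products, determinants) apply to it. *)
Lemma dzE j f x : dz j f x = fder (cstF (ex R j, 0)) f x.
Proof.
rewrite /fder /= (bigD1 j) //= !mxE !eqxx /= mul1r mul0r addr0 big1 ?addr0 //.
by move=> k kj; rewrite !mxE (negbTE kj) !mul0r addr0.
Qed.

Lemma dzbE j f x : dzb j f x = fder (cstF (0, ex R j)) f x.
Proof.
rewrite /fder /= (bigD1 j) //= !mxE !eqxx /= mul1r mul0r add0r big1 ?addr0 //.
by move=> k kj; rewrite !mxE (negbTE kj) !mul0r addr0.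
Qed.

Lemma dz_dzb_comm j k U f x : open U -> Ck 2 U f -> U x ->
  dzb k (dz j f) x = dz j (dzb k f) x.
Proof.
move=> oU Cf Ux; have [_ df] := Cf.
have lin v (c d : R[i]) g h : derivableR v g x -> derivableR v h x ->
    derR v (fun y => c * (g y + d * h y)) x = c * (derR v g x + d * derR v h x).
  move=> dg dh; have [d1 _] := derivableR_cst v c x; have [d2 _] := derivableR_cst v d x.
  have [d3 E3] := derivableR_mul d2 dh; have [d4 E4] := derivableR_add dg d3.
  have [_ ->] := derivableR_mul d1 d4.
  by rewrite E4 E3 !(derivableR_cst _ _ _).2 !mul0r !add0r.
pose basis v := exists l, v = ex R l \/ v = ey R l.
have d2 v w : basis v -> basis w -> derivableR w (derR v f) x.
  move=> [l vE] [l' wE]; have [_ C1] := df l v vE.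
  exact: (@Ck_dfb R n 0 U _ x C1 Ux l' w wE).
have key v1 v2 w1 w2 : basis v1 -> basis v2 -> basis w1 -> basis w2 ->
    2^-1 * (derR w1 (fun y => 2^-1 * (derR v1 f y + - 'i%C * derR v2 f y)) x
            + 'i%C * derR w2 (fun y => 2^-1 * (derR v1 f y + - 'i%C * derR v2 f y)) x) =
    2^-1 * (derR v1 (fun y => 2^-1 * (derR w1 f y + 'i%C * derR w2 f y)) x
            - 'i%C * derR v2 (fun y => 2^-1 * (derR w1 f y + 'i%C * derR w2 f y)) x).
  move=> bv1 bv2 bw1 bw2.
  rewrite (lin _ _ _ _ _ (d2 _ _ bv1 bw1) (d2 _ _ bv2 bw1)).
  rewrite (lin _ _ _ _ _ (d2 _ _ bv1 bw2) (d2 _ _ bv2 bw2)).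
  rewrite (lin _ _ _ _ _ (d2 _ _ bw1 bv1) (d2 _ _ bw2 bv1)).
  rewrite (lin _ _ _ _ _ (d2 _ _ bw1 bv2) (d2 _ _ bw2 bv2)).
  rewrite (derR_comm oU Cf Ux bv1 bw1) (derR_comm oU Cf Ux bv1 bw2).
  rewrite (derR_comm oU Cf Ux bv2 bw1) (derR_comm oU Cf Ux bv2 bw2).
  move: (derR v1 (derR w1 f) x) (derR v1 (derR w2 f) x) => a b.
  move: (derR v2 (derR w1 f) x) (derR v2 (derR w2 f) x) => c d.
  (* After the four commutations the identity is polynomial and holds for arbitrary scalars in place
     of 1/2 and 'i, which [ring] may treat as indeterminates. *)
  congr (_ * _); move: (2^-1) 'i%C => h u.
  ring.
have hx l : basis (ex R l) by exists l; left.
have hy l : basis (ey R l) by exists l; right.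
have -> : dz j f = fun y => 2^-1 * (derR (ex R j) f y + - 'i%C * derR (ey R j) f y).
  by apply/funext => y; rewrite mulNr.
exact: key.
Qed.

End DeterminantDerivative.

(** * The Chern connection in a chart and its curvature term *)

Section ChernCurvature.
Variables (R : realType) (n : nat).
Implicit Types (f : Cn R n -> R[i]) (x v w Z : Cn R n).

Lemma herm_ex (H : 'M[R[i]]_n) j k : herm H (ex R j) (ex R k) = H j k.
Proof.
rewrite /herm (bigD1 j) //= [X in _ + X]big1 ?addr0; last first.
  by move=> i ij; rewrite big1 // => l _; rewrite mxE (negbTE ij) !mul0r.
rewrite (bigD1 k) //= big1 ?addr0; last first.
  by move=> i ik; rewrite !mxE (negbTE ik) conjc0 mulr0.
by rewrite !mxE !eqxx mul1r conjc1 mulr1.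
Qed.

Lemma smoothV_cst U v : smoothV U (fun=> v : Cn R n).
Proof. by move=> j k; exact: Ck_cst. Qed.

Lemma smoothF_cst U (u : cvec R n) : smoothF U (cstF u).
Proof. by split; exact: smoothV_cst. Qed.

Lemma fderV_cst X v x : fderV X (fun=> v) x = 0 :> Cn R n.
Proof. by apply/rowP => j; rewrite !mxE fder_cst. Qed.

Lemma nabla_cst (G : connection R n) (u : cvec R n) v x :
  nabla G (cstF u) (fun=> v) x =
  v *m \sum_j (u.1 0 j *: conn_z G j x + u.2 0 j *: conn_zb G j x).
Proof. by rewrite /nabla fderV_cst add0r. Qed.

Lemma Ck_dz k U j f : open U -> Ck k.+1 U f -> Ck k U (dz j f).
Proof.
move=> oU [_ df]; have [_ Cx] := df j _ (or_introl erefl).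
have [_ Cy] := df j _ (or_intror erefl).
have C := CkM oU (Ck_cst k U 2^-1) (CkD oU Cx (CkN oU (CkM oU (Ck_cst k U 'i%C) Cy))).
exact: (Ck_ext oU _ C).
Qed.

Lemma Ck_dzb k U j f : open U -> Ck k.+1 U f -> Ck k U (dzb j f).
Proof.
move=> oU [_ df]; have [_ Cx] := df j _ (or_introl erefl).
have [_ Cy] := df j _ (or_intror erefl).
exact: (CkM oU (Ck_cst k U 2^-1) (CkD oU Cx (CkM oU (Ck_cst k U 'i%C) Cy))).
Qed.

(* log |det h|, written so that the positivity of det h need not be proved. *)
Definition half_ln_sqr_det (h : Cn R n -> 'M[R[i]]_n) x : R :=
  2^-1 * ln (complex.Re (\det (h x)) ^+ 2).

Variables (U : set (Cn R n)) (h : Cn R n -> 'M[R[i]]_n).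
Hypothesis oU : open U.
Hypothesis hs : forall j k, smooth U (fun x => h x j k).
Hypothesis hh : forall x, U x -> forall v w, herm (h x) w v = (conjc (herm (h x) v w)).
Hypothesis hp : forall x, U x -> forall v, v != 0 -> 0 < herm (h x) v v.

Lemma gram_det_neq0 x : U x -> \det (h x) != 0.
Proof. by move=> Ux; rewrite -unitfE -unitmxE; exact: (h_unit hp). Qed.

(** Conjugating a Hermitian matrix transposes it, and transposition preserves the determinant, which
    is therefore fixed by conjugation. *)
Lemma gram_det_real x : U x -> (complex.Re (\det (h x)))%:C = \det (h x).
Proof.
move=> Ux; have E : conjc (\det (h x)) = \det (h x).
  rewrite -(det_map_mx (conjc : {rmorphism R[i] -> R[i]})) -[RHS]det_tr.
  by congr (\det _); apply/matrixP => j k; rewrite !mxE; exact: (h_conj hh).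
move: E; case: (\det (h x)) => p q /eqP; rewrite eq_complex /= => /andP[_].
by rewrite eqNr => /eqP ->.
Qed.

Lemma gram_detV_real x : U x ->
  ((complex.Re (\det (h x)))^-1)%:C = (\det (h x))^-1.
Proof.
by move=> Ux; rewrite -[in RHS]gram_det_real //; exact: (fmorphV (real_complex R)).
Qed.

Lemma gram_Re_det_neq0 x : U x -> complex.Re (\det (h x)) != 0.
Proof.
move=> Ux; apply: contraNneq (gram_det_neq0 Ux) => E.
by rewrite -(gram_det_real Ux) E.
Qed.

Lemma Ck_Re_det k : Ck k U (fun x => (complex.Re (\det (h x)))%:C).
Proof.
have C := Ck_det oU (fun i j => hs i j k).
by apply: (Ck_ext oU _ C) => x Ux; rewrite gram_det_real.
Qed.

Lemma Ck_half_ln_sqr_det k : Ck k U (fun x => (half_ln_sqr_det h x)%:C).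
Proof. exact: (Ck_ln_sqr oU gram_Re_det_neq0 (Ck_Re_det k)). Qed.

(** Jacobi's formula with the adjugate divided by the determinant; the right-hand side is the trace
    of the connection matrix found in [chern_conn_z]. *)
Lemma dz_half_ln_sqr_det l x : U x ->
  dz l (fun y => (half_ln_sqr_det h y)%:C) x = \tr (Dh h l x *m invmx (h x)).
Proof.
move=> Ux; rewrite (dz_ln_sqr l (gram_Re_det_neq0 Ux) (Ck_dfb (Ck_Re_det 1) Ux)).
rewrite dzE (fder_near _ (near_open oU gram_det_real Ux)).
rewrite (fder_det _ (fun i j => Ck_dfb (hs i j 1) Ux)).
have -> : invmx (h x) = (\det (h x))^-1 *: \adj (h x) by rewrite /invmx (h_unit hp Ux).
rewrite -scalemxAr mxtraceZ -(gram_detV_real Ux).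
congr (_ * \tr (_ *m _)); apply/matrixP => i j.
by rewrite !mxE dzE.
Qed.

Variable G : connection R n.
Hypothesis chG : is_chern U h G.

(** For the constant field d/dzbar_m and the constant section [ex k], the covariant derivative is
    row [k] of the coefficient matrix, while the (0,1)-condition makes it a derivative of a
    constant. *)
Lemma chern_conn_zb m x : U x -> conn_zb G m x = 0.
Proof.
move=> Ux; apply/row_matrixP => k; rewrite row0.
have := chG.1 (cstF (0, ex R m)) (fun=> ex R k) (smoothF_cst _ _) (smoothV_cst _ _) x Ux erefl.
rewrite nabla_cst fderV_cst (bigD1 m) //= big1 => [|j jm]; last first.
  by rewrite !mxE (negbTE jm) !scale0r addr0.
by rewrite !mxE !eqxx scale0r scale1r add0r addr0 -rowE.
Qed.

Lemma chern_conn_z l x : U x -> conn_z G l x = Dh h l x *m invmx (h x).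
Proof.
move=> Ux; apply: (canRL (mulmxK (h_unit hp Ux))); apply/matrixP => j k.
have conj0 : conjV 0 = 0 :> Cn R n by apply/rowP => i; rewrite !mxE conjc0.
have := chG.2 (cstF (ex R l, 0)) (fun=> ex R j) (fun=> ex R k) (smoothF_cst _ _)
  (smoothV_cst _ _) (smoothV_cst _ _) x Ux.
(* The conjugate of d/dz_l is of type (0,1), so the second term of metric compatibility vanishes on
   constant sections and dh/dz_l = [conn_z] h remains. *)
rewrite (chG.1 (Fbar _) _ (smoothF_cst U (cbar (ex R l, 0))) (smoothV_cst _ _) x Ux) //.
have -> : nabla G (cstF (ex R l, 0)) (fun=> ex R j) x = ex R j *m conn_z G l x.
  rewrite nabla_cst (bigD1 l) //= big1 => [|i il]; last first.
    by rewrite !mxE (negbTE il) !scale0r addr0.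
  by rewrite !mxE !eqxx scale0r scale1r !addr0.
rewrite fderV_cst hermMl herm_ex -dzE.
have -> : herm (h x) (ex R j) 0 = 0.
  rewrite /herm big1 // => a _; rewrite big1 // => b _.
  have -> : (0 : Cn R n) 0 b = 0 :> R[i] by rewrite mxE.
  by rewrite conjc0 mulr0.
rewrite addr0 => <-; rewrite mxE; congr (dz l _ x).
by apply/funext => y; exact: herm_ex.
Qed.

(** By Cramer's rule the entries of (dh) h^-1 are polynomial in 1/det h, the entries of h and their
    first derivatives. The curvature differentiates these coefficients once more. *)
Lemma chern_conn_z_Ck k l i j : Ck k U (fun x => conn_z G l x i j).
Proof.
have CD a b : Ck k U (dz l (fun x => h x a b)) by exact: (Ck_dz _ oU (hs a b k.+1)).
have CV := CkV_real oU gram_Re_det_neq0 (Ck_Re_det k).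
have CA a b : Ck k U (fun x => (\adj (h x)) a b).
  have CM := Ck_det (A := fun x => row' b (col' a (h x))) oU
    (fun c d => Ck_ext oU (fun x _ => _) (hs (lift b c) (lift a d) k)).
  have C := CkM oU (Ck_cst k U ((-1) ^+ (b + a))) (CM _).
  apply: (Ck_ext oU _ (C _)) => [x _|c d x]; by rewrite !mxE.
have C := Ck_sum (index_enum 'I_n) oU (fun a => CkM oU (CD i a) (CkM oU CV (CA a j))).
apply: (Ck_ext oU _ C) => x Ux.
rewrite chern_conn_z // mxE; apply: eq_bigr => a _.
by rewrite /invmx (h_unit hp Ux) !mxE gram_detV_real.
Qed.

(* The curvature involves d/dzbar_m d/dz_l of log |det h|, and ddbar the
   derivatives in the opposite order, hence the use of Schwarz's theorem. *)
Lemma Theta_chern x Z : U x ->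
  Theta G x Z Z = - ddbar (fun y => (half_ln_sqr_det h y)%:C) x Z.
Proof.
move=> Ux; set F := fun y => (half_ln_sqr_det h y)%:C.
pose X : cfield R n := cstF (Z, 0); pose Y : cfield R n := cstF (0, conjV Z).
have nearU P : (forall y, U y -> P y) -> \forall y \near x, P y.
  by move=> H; move: oU; rewrite openE => /(_ _ Ux); apply: filterS.
(* The frame is holomorphic, so [nabla G Y] kills it on [U], and constant fields have zero bracket.
   Only the term with [Y] outermost survives, whence the minus sign. *)
have curvE j : curvature G X Y (fun=> ex R j) x 0 j =
    - fder Y (fun y => \sum_l Z 0 l * conn_z G l y j j) x.
  have nY y : U y -> nabla G Y (fun=> ex R j) y = 0.
    by move=> Uy; rewrite (chG.1 Y _ (smoothF_cst _ _) (smoothV_cst _ _) y Uy) ?fderV_cst.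
  have E1 : nabla G X (nabla G Y (fun=> ex R j)) x = 0.
    rewrite {1}/nabla nY // mul0mx addr0; apply/rowP => k.
    rewrite !mxE -(fder_cst X 0 x); apply: fder_near; apply: nearU => y Uy.
    by rewrite nY // mxE.
  have E3 : nabla G (bracket X Y) (fun=> ex R j) x = 0.
    have -> : bracket X Y = cstF 0.
      apply/funext => y; rewrite /bracket /X /Y.
      by rewrite !(fderV_cst, subr0).
    rewrite nabla_cst big1 ?mulmx0 // => k _.
    by rewrite !mxE !scale0r addr0.
  rewrite /curvature E1 E3 subr0 sub0r mxE; congr (- _).
  rewrite {1}/nabla big1 => [|m _]; last first.
    by rewrite chern_conn_zb // scaler0 addr0 mxE scale0r.
  rewrite mulmx0 addr0 mxE; apply: fder_near; apply: nearU => y Uy.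
  rewrite nabla_cst -rowE mxE summxE; apply: eq_bigr => l _.
  by rewrite /= !mxE mul0r addr0.
have Ccz k l j : Ck k U (fun y => Z 0 l * conn_z G l y j j).
  by apply: CkM => //; [exact: Ck_cst|exact: chern_conn_z_Ck].
have dS j : dfb (fun y => \sum_l Z 0 l * conn_z G l y j j) x.
  by apply: (@Ck_dfb R n 0 U _ x _ Ux); apply: Ck_sum => // l; exact: (Ccz 1).
have CF k : Ck k U F by exact: Ck_half_ln_sqr_det.
have dF l : dfb (dz l F) x.
  by apply: (@Ck_dfb R n 0 U _ x _ Ux); apply: Ck_dz => //; exact: (CF 2).
have dZF l : dfb (fun y => Z 0 l * dz l F y) x := (fder_mul Y (dfb_cst (Z 0 l) x) (dF l)).1.
rewrite /Theta (eq_bigr _ (fun j _ => curvE j)) sumrN; congr (- _).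
rewrite -(fder_sum Y _ dS).2.
(* The diagonal coefficients sum to the trace of the connection matrix, that is to [dz l F]. This
   holds on [U] only, so germs are compared. *)
transitivity (fder Y (fun y => \sum_l Z 0 l * dz l F y) x).
  apply: fder_near; apply: nearU => y Uy; rewrite exchange_big; apply: eq_bigr => l _.
  by rewrite dz_half_ln_sqr_det // -chern_conn_z // mulr_sumr.
rewrite (fder_sum Y _ dZF).2; apply: eq_bigr => l _.
rewrite fder_scale // mulr_sumr; apply: eq_bigr => m _.
rewrite /= !mxE mul0r add0r (dz_dzb_comm _ _ oU (CF 2) Ux).
by rewrite mulrA [LHS]mulrC mulrA.
Qed.

End ChernCurvature.

(** * Behaviour of the determinants under change of chart, and the global function psi *)

Section ChartChange.
Variables (R : realType) (n : nat).

Lemma fderB X (f g : Cn R n -> R[i]) x : dfb f x -> dfb g x ->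
  fder X (fun y => f y - g y) x = fder X f x - fder X g x.
Proof.
move=> df dg; have dg' := (fder_mul X (dfb_cst (-1) x) dg).1.
have -> : (fun y => f y - g y) = (fun y => f y + -1 * g y).
  by apply/funext => y; rewrite mulN1r.
by rewrite (fder_add X df dg').2 fder_scale // mulN1r.
Qed.

(** As [k] is known on [U] only, the first-order identity is established on all of [U] before being
    differentiated at [x]. *)
Lemma ddbarB U (f g k : Cn R n -> R[i]) x Z : open U -> U x -> Ck 2 U f -> Ck 2 U g ->
  (forall y, U y -> k y = f y - g y) -> ddbar k x Z = ddbar f x Z - ddbar g x Z.
Proof.
move=> oU Ux Cf Cg kE; rewrite /ddbar -sumrB; apply: eq_bigr => j _.
rewrite -sumrB; apply: eq_bigr => l _; rewrite -mulrBl -mulrBl; congr (_ * _ * _).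
have dzbC (f' : Cn R n -> R[i]) : Ck 2 U f' -> dfb (dzb l f') x.
  by move=> Cf'; apply: (@Ck_dfb R n 0 U _ x _ Ux); exact: Ck_dzb.
have E y : U y -> dzb l k y = dzb l f y - dzb l g y.
  move=> Uy; rewrite (dzbE l k) (dzbE l f) (dzbE l g) (fder_near _ (near_open oU kE Uy)).
  by rewrite fderB //; [exact: (@Ck_dfb R n 1 U f y Cf Uy)|exact: (@Ck_dfb R n 1 U g y Cg Uy)].
rewrite (dzE j (dzb l k)) (dzE j (dzb l f)) (dzE j (dzb l g)).
rewrite (fder_near _ (near_open oU E Ux)).
exact: (fderB _ (dzbC f Cf) (dzbC g Cg)).
Qed.

(** Testing on basis vectors gives H = J H' J^*, where the rows of J are the images of the basis.
    The factor det J times its conjugate is displayed as a real number so that it passes through the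
    real part in [half_ln_sqr_det]. *)
Lemma det_herm_pullback (H H' : 'M[R[i]]_n) (L : Cn R n -> Cn R n) :
  (forall v w, herm H v w = herm H' (L v) (L w)) ->
  \det H = (complex.Re (`|\det (\matrix_(j, k) L (ex R j) 0 k)| ^+ 2))%:C * \det H'.
Proof.
move=> HL; set J : 'M[R[i]]_n := \matrix_(j, k) _.
have -> : H = J *m H' *m (map_mx conjc J)^T.
  apply/matrixP => j k; rewrite -(herm_ex H j k) HL mxE /herm exchange_big.
  apply: eq_bigr => b _; rewrite !mxE mulr_suml; apply: eq_bigr => a _.
  by rewrite !mxE.
rewrite !det_mulmx det_tr det_map_mx mulrAC; congr (_ * _).
move: (\det J) => [p q]; rewrite sqr_normc /=.
by apply/eqP; rewrite eq_complex /= eqxx /= [q * p]mulrC mulrN addNr.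
Qed.

(** The common term (1/2) ln c^2 cancels in the difference; that [c] and the determinants at [x']
    are nonzero follows from the nonvanishing at [x]. *)
Lemma half_ln_sqr_det_sub_scale (c : R) (h k h' k' : Cn R n -> 'M[R[i]]_n) x x' :
  \det (h x) = c%:C * \det (h' x') -> \det (k x) = c%:C * \det (k' x') ->
  complex.Re (\det (h x)) != 0 -> complex.Re (\det (k x)) != 0 ->
  half_ln_sqr_det h x - half_ln_sqr_det k x =
  half_ln_sqr_det h' x' - half_ln_sqr_det k' x'.
Proof.
have ReM (z : R[i]) : complex.Re (c%:C * z) = c * complex.Re z.
  by case: z => p q /=; rewrite mul0r subr0.
rewrite /half_ln_sqr_det => -> ->; rewrite !ReM !mulf_eq0 !negb_or.
move=> /andP[c0 a0] /andP[_ b0].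
have pos (t : R) : t != 0 -> t ^+ 2 \is Num.pos.
  by move=> t0; rewrite posrE lt_def sqrf_eq0 t0 sqr_ge0.
by rewrite !exprMn (lnM (pos _ c0) (pos _ a0)) (lnM (pos _ c0) (pos _ b0)); ring.
Qed.

Variable M : complex_manifold R n.

Definition log_det_ratio (g g' : hermitian_metric M) (c : chart R n M) x : R :=
  half_ln_sqr_det (gram g c) x - half_ln_sqr_det (gram g' c) x.

Lemma gram_herm_range (g : hermitian_metric M) c : atlas c ->
  forall x, (chmap c @` chdom c) x -> forall v w,
  herm (gram g c x) w v = conjc (herm (gram g c x) v w).
Proof. by move=> ac _ [p cp <-]; exact: gram_herm. Qed.

Lemma gram_pos_range (g : hermitian_metric M) c : atlas c ->
  forall x, (chmap c @` chdom c) x -> forall v, v != 0 -> 0 < herm (gram g c x) v v.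
Proof. by move=> ac _ [p cp <-]; exact: gram_pos. Qed.

Lemma log_det_ratio_chart (g g' : hermitian_metric M) c c' p :
  atlas c -> atlas c' -> chdom c p -> chdom c' p ->
  log_det_ratio g g' c (chmap c p) = log_det_ratio g g' c' (chmap c' p).
Proof.
move=> ac ac' cp cp'; have Up : (chmap c @` chdom c) (chmap c p) by exists p.
have E g0 := det_herm_pullback (gram_compat g0 ac ac' cp cp').
have N g0 := gram_Re_det_neq0 (gram_herm_range g0 ac) (gram_pos_range g0 ac) Up.
exact: half_ln_sqr_det_sub_scale (E g) (E g') (N g) (N g').
Qed.

Lemma log_det_ratio_global (g g' : hermitian_metric M) :
  exists psi : M -> R, forall c p, atlas c -> chdom c p ->
    psi p = log_det_ratio g g' c (chmap c p).
Proof.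
have [F aF dF] : exists2 F : M -> chart R n M, forall p, atlas (F p) & forall p, chdom (F p) p.
  exists (fun p => s2val (cid2 (atlas_cover p))) => p.
    exact: (s2valP (cid2 (atlas_cover p))).
  exact: (s2valP' (cid2 (atlas_cover p))).
exists (fun p => log_det_ratio g g' (F p) (chmap (F p) p)) => c p ac cp.
exact: log_det_ratio_chart.
Qed.

Lemma sqnorm2_ge0 (H : 'M[R[i]]_n) omega : 0 <= sqnorm2 H omega.
Proof. by apply: sumr_ge0 => j _; apply: sumr_ge0 => k _; exact: exprn_ge0. Qed.

End ChartChange.

Theorem proposition3p3 (R : realType) (n : nat) (n_ge2 : (2 <= n)%N)
  (M : complex_manifold R n)
  (g gt : hermitian_metric M) (g_kaehler : kaehler g)
  (D Dt : chart R n M -> connection R n)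
  (D_chern : chern_connection g D) (Dt_chern : chern_connection gt Dt)
  (Omega : set M) (Omega_dom : relcompact_domain Omega)
  (Omega_lip : lipschitz_boundary Omega)
  (a b : R) (a_ge0 : 0 <= a) (a_lt_b : a < b) (b_le1 : b <= 1)
  (rho : M -> R) (rho_def : lipschitz_defining Omega rho)
  (rho_C2 : C2_on Omega rho)
  (rho_ineq : forall eta : R, eta = a \/ eta = b ->
    forall (p : M) (c : chart R n M), Omega p -> atlas c -> chdom c p ->
    forall Z : Cn R n,
      ((- rho p) `^ eta)%:C
        * sqnorm2 (gram gt c (chmap c p))
            (tau (Dt c) (chmap c p) (flat (gram gt c (chmap c p)) Z))
      <= ((- rho p) `^ eta)%:C * Theta (Dt c) (chmap c p) Z Z
         - ddbar (fun x => ((- rho (chinv c x)) `^ eta)%:C) (chmap c p) Z) :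
  exists psi : M -> R, C2_on setT psi /\
    forall eta : R, eta = a \/ eta = b ->
    forall (p : M) (c : chart R n M), Omega p -> atlas c -> chdom c p ->
    forall Z : Cn R n,
      0 <= ((- rho p) `^ eta)%:C
             * (Theta (D c) (chmap c p) Z Z
                + ddbar (fun x => (psi (chinv c x))%:C) (chmap c p) Z)
           - ddbar (fun x => ((- rho (chinv c x)) `^ eta)%:C) (chmap c p) Z.
Proof.
have [psi psiE] := log_det_ratio_global g gt.
have oU (c : chart R n M) : open (chmap c @` chdom c) := @chmap_open _ _ _ c.
have CF (h : hermitian_metric M) c (ac : atlas c) := Ck_half_ln_sqr_det (oU c)
  (gram_smooth h ac) (gram_herm_range h ac) (gram_pos_range h ac) 2.
have psi_loc (c : chart R n M) x : atlas c -> (chmap c @` chdom c) x ->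
    (psi (chinv c x))%:C =
    (half_ln_sqr_det (gram g c) x)%:C - (half_ln_sqr_det (gram gt c) x)%:C :> R[i].
  by move=> ac [p cp <-]; rewrite chmapK // (psiE c p ac cp) -raddfB.
exists psi; split=> [c ac|eta etaE p c Op ac cp Z].
  rewrite setIT.
  (* [chinv c] is arbitrary off the range of the chart, so psi in coordinates is compared with the
     difference of logarithms on that range only. *)
  apply: (Ck_ext (oU c) _ (CkD (oU c) (CF g c ac) (CkN (oU c) (CF gt c ac)))) => x Ux.
  by rewrite psi_loc.
have Up : (chmap c @` chdom c) (chmap c p) by exists p.
have ThE (h : hermitian_metric M) G (chG : chern_connection h G) :=
  Theta_chern (oU c) (gram_smooth h ac) (gram_herm_range h ac) (gram_pos_range h ac)
    (chG c ac) Z Up.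
have -> : Theta (D c) (chmap c p) Z Z +
    ddbar (fun x => (psi (chinv c x))%:C) (chmap c p) Z = Theta (Dt c) (chmap c p) Z Z.
  rewrite (ddbarB Z (oU c) Up (CF g c ac) (CF gt c ac) (fun x => psi_loc c x ac)).
  by rewrite (ThE g D D_chern) (ThE gt Dt Dt_chern) addKr.
apply: le_trans (rho_ineq eta etaE p c Op ac cp Z).
by rewrite mulr_ge0 ?sqnorm2_ge0 // lecR powR_ge0.
Qed.
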